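(* Let $n\ge 6$ be an integer and let $K(n,3)$ be the Kneser graph whose vertices are the $3$-element subsets of $[n]=\{1,\ldots,n\}$, two vertices being adjacent if and only if they are disjoint. Then \[ \mathrm{gp}(K(n,3)) = \begin{cases} 20, & n=6,\\ \binom{n-1}{2}, & n\ge 7. \end{cases} \]
   Context: Graphs are finite, undirected and simple. For a graph $G$, $d_G$ is the shortest-path distance; a $u,v$-geodesic is a $u,v$-path of length $d_G(u,v)$ (vertices in different connected components are joined by no geodesic). A set $S\subseteq V(G)$ is a general position set of $G$ if no vertex of $S$ lies on a geodesic between two other vertices of $S$; that is, for no three pairwise different $u,v,w\in S$ lying in one connected component does $d_G(u,v)=d_G(u,w)+d_G(w,v)$ hold. The general position number $\mathrm{gp}(G)$ is the maximum cardinality of a general position set of $G$. *)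

(* Defs.v *)
From mathcomp Require Import all_boot.

Set Implicit Arguments.
Unset Strict Implicit.
Unset Printing Implicit Defensive.

(* Finite simple graphs are symmetric irreflexive relations; neither property
   is needed to state the definitions. *)

Section GeneralPosition.

Variables (T : finType) (e : rel T).

Definition walk (k : nat) (u v : T) : bool :=
  [exists p : k.-tuple T, path e u p && (last u p == v)].

(* A shortest walk is a path, so it has length less than #|T|.  The value is *)
(* the junk #|T| when u and v lie in different components; definitions below *)
(* therefore guard the use of gdist by connect. *)
Definition gdist (u v : T) : nat := find (fun k => walk k u v) (iota 0 #|T|).

Definition general_position (S : {set T}) : bool :=
  [forall u in S, forall v in S, forall w in S,
    [&& u != v, u != w, w != v, connect e u w & connect e w v]
      ==> (gdist u v != gdist u w + gdist w v)].

Definition gp : nat := \max_(S : {set T} | general_position S) #|S|.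

Lemma walkP k u v :
  reflect (exists p, [/\ path e u p, last u p = v & size p = k]) (walk k u v).
Proof.
apply: (iffP existsP) => [[p /andP[up /eqP pv]]|[p [up pv <-]]].
  by exists p; rewrite size_tuple.
by exists (in_tuple p); rewrite up pv eqxx.
Qed.

Lemma gdist_le u p : path e u p -> gdist u (last u p) <= size p.
Proof.
move=> up; have [lt|ge] := ltnP (size p) #|T|; last first.
  by apply: leq_trans ge; rewrite /gdist -[leqRHS](size_iota 0) find_size.
rewrite leqNgt; apply/negP => /(before_find 0).
rewrite nth_iota // add0n; suff -> : walk (size p) u (last u p) by [].
by apply/walkP; exists p.
Qed.

Lemma gdist_walk u v : connect e u v -> walk (gdist u v) u v.
Proof.
case/connectP => p up ->; case/shortenP: up => q uq q_uniq _.
have lt : size q < #|T|.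
  by have := max_card (mem (u :: q)); rewrite (card_uniqP q_uniq).
have h : has (fun k => walk k u (last u q)) (iota 0 #|T|).
  by apply/hasP; exists (size q); rewrite ?mem_iota //; apply/walkP; exists q.
have := nth_find 0 h; rewrite nth_iota //.
by have := h; rewrite has_find size_iota.
Qed.

Definition geodesic (u v : T) (p : seq T) : Prop :=
  [/\ path e u p, last u p = v &
      forall q, path e u q -> last u q = v -> size p <= size q].

Lemma geodesicP u v p :
  geodesic u v p <-> [/\ path e u p, last u p = v & size p = gdist u v].
Proof.
split=> [[up pv pmin]|[up pv sp]].
  split=> //; apply/eqP; rewrite eqn_leq -{2}pv gdist_le // andbT.
  have /walkP[q [uq qv <-]] : walk (gdist u v) u v.
    by apply: gdist_walk; apply/connectP; exists p.
  exact: pmin.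
by split=> // q uq qv; rewrite sp -qv gdist_le.
Qed.

Lemma general_positionP (S : {set T}) :
  reflect (forall u v w p, u \in S -> v \in S -> w \in S ->
             w != u -> w != v -> u != v -> geodesic u v p -> w \notin u :: p)
          (general_position S).
Proof.
apply: (iffP idP) => [gpS u v w p uS vS wS wu wv uv /geodesicP[up pv sp]|H].
  apply/negP; rewrite inE (negPf wu) /= => wp.
  case/splitPr: wp up pv sp => p1 p2.
  rewrite -cat_rcons cat_path last_cat last_rcons size_cat.
  case/andP=> up1 wp2 pv sp.
  have uw : connect e u w.
    by apply/connectP; exists (rcons p1 w); rewrite ?last_rcons.
  have wv' : connect e w v.
    by apply/connectP; exists p2; rewrite // -pv.
  have := gpS => /forall_inP/(_ u uS)/forall_inP/(_ v vS)/forall_inP/(_ w wS).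
  rewrite uv eq_sym wu wv uw wv' /= => /eqP; apply.
  have := gdist_le up1; rewrite last_rcons => le1.
  have := gdist_le wp2; rewrite pv => le2.
  have le : gdist u w + gdist w v <= gdist u v by rewrite -sp leq_add.
  have /walkP[q1 [uq1 q1w s1]] := gdist_walk uw.
  have /walkP[q2 [wq2 q2v s2]] := gdist_walk wv'.
  apply/eqP; rewrite eqn_leq le andbT -s1 -s2 -size_cat -{1}q2v -{1}q1w.
  by rewrite -last_cat gdist_le // cat_path uq1 q1w.
apply/forall_inP => u uS; apply/forall_inP => v vS; apply/forall_inP => w wS.
apply/implyP => /and5P[uv uw wv cuw cwv]; apply/negP => /eqP d.
have /walkP[q1 [uq1 q1w s1]] := gdist_walk cuw.
have /walkP[q2 [wq2 q2v s2]] := gdist_walk cwv.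
have : w \notin u :: q1 ++ q2.
  apply: (H u v) => //; first by rewrite eq_sym.
  by apply/geodesicP; rewrite cat_path last_cat size_cat uq1 q1w wq2 q2v s1 s2.
by rewrite -cat_cons mem_cat -q1w mem_last.
Qed.

End GeneralPosition.

Notation ksubset n k := {A : {set 'I_n} | #|A| == k}.

Definition kneser (n k : nat) : rel (ksubset n k) :=
  fun A B => [disjoint val A & val B].

Lemma kneser_sym n k : symmetric (@kneser n k).
Proof. by move=> A B; rewrite /kneser disjoint_sym. Qed.

Lemma kneser_irr n k : 0 < k -> irreflexive (@kneser n k).
Proof.
move=> k0 A; rewrite /kneser -setI_eq0 setIid -cards_eq0 (eqP (valP A)).
by case: k k0 A.
Qed.

Arguments kneser n k : clear implicits.

(* Main.v *)
(* A member of a general position set disjoint from two others makes them disjoint.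
   If the triples pairwise meet, this is Erdos-Ko-Rado.  Otherwise fix disjoint
   members A and B.  Apart from triples missing both, the others are either inner
   (contained in A :|: B) or mixed, [{a, b, x}] with a in A, b in B, x outside.
   For each of the 9 positions (a, b), four triples inside A :|: B avoid a and b; all
   of them are disjoint from every mixed triple over (a, b), so that
     (inner triples avoiding a and b) + 2 min (mixed triples over (a, b), 2) <= 4.
   Summing over the positions, where each inner triple is counted twice, gives
   (inner) + sum of min (mixed over (a, b), 2) <= 18.  A position carrying three mixed
   triples empties those that differ from it in both coordinates, so the excess is
   at most 8 (n - 8), and 2 + 18 + 8 (n - 8) <= 'C(n - 1, 2).  In K(7,3) distances 3
   exclude the inner triples, which leaves at most 2 + 9. *)

Require Import Defs.
From mathcomp Require Import all_boot all_fingroup.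
From mathcomp Require Import zify.
Set Implicit Arguments.
Unset Strict Implicit.
Unset Printing Implicit Defensive.

(** Equivalently, the disjointness graph on [F] has no induced path on three vertices: it is a
    cluster graph, a disjoint union of cliques. *)
Definition cluster (T : finType) (F : {set {set T}}) :=
  forall C D E, C \in F -> D \in F -> E \in F -> D != E ->
    [disjoint D & C] -> [disjoint E & C] -> [disjoint D & E].

(* [2 ('C(n - 1, 2) - 20 - 8 (n - 8)) = (n - 9) (n - 10)] *)
Lemma linear_le_bin2 n : 8 <= n -> 20 + 8 * (n - 8) <= 'C(n.-1, 2).
Proof.
case: n => [|[|[|[|[|[|[|[|[|[|k]]]]]]]]]] //= _.
have := mul_bin_diag k.+1.+4.+4 1; rewrite bin1 /=.
move: 'C(_, _) => c; nia.
Qed.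

(** * Clusters of triples that contain a disjoint pair *)

Section DisjointPair.

Variables (T : finType) (F : {set {set T}}) (A B : {set T}).
Hypotheses (F3 : {in F, forall D : {set T}, #|D| = 3}) (Fcl : cluster F).
Hypotheses (FA : A \in F) (FB : B \in F) (dAB : [disjoint A & B]).

Let outer := [set D in F | [disjoint D & A] & D != B].
Let inner := [set D in F | [&& D \subset A :|: B, D != A & D != B]].
Let mixed := [set D in F | ~~ [disjoint D & A] & ~~ (D \subset A :|: B)].
Let fiber (p : T * T) := [set D in mixed | (p.1 \in D) && (p.2 \in D)].

Lemma disjointIn (D E : {set T}) x : [disjoint D & E] -> x \in D -> x \in E -> False.
Proof. by move=> dDE xD xE; have := disjointFr dDE xD; rewrite xE. Qed.

Lemma cover_pair : #|F| <= 2 + #|outer| + #|inner| + #|mixed|.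
Proof.
have sF : F \subset [set A; B] :|: outer :|: inner :|: mixed.
  apply/subsetP => D FD; rewrite !inE FD /=.
  case: (D =P A) => //= _; case: (D =P B) => //= _.
  by case: [disjoint D & A] => //=; case: (D \subset _).
apply: leq_trans (subset_leq_card sF) _.
apply: leq_trans (leq_card_setU _ _) _; rewrite leq_add2r.
apply: leq_trans (leq_card_setU _ _) _; rewrite leq_add2r.
apply: leq_trans (leq_card_setU _ _) _; rewrite leq_add2r.
by rewrite cards2; case: (A != B).
Qed.

Lemma outerP D : D \in outer -> [/\ D \in F, [disjoint D & A] & [disjoint D & B]].
Proof.
rewrite inE => /and3P[FD dDA nDB]; split=> //.
by apply: (Fcl FA) => //; rewrite disjoint_sym.
Qed.

(** If [D] missed [B], then [D] and [A] would both be disjoint from [B], hence from each other. *)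
Lemma meet_both D : D \in F -> D != A -> ~~ [disjoint D & A] -> ~~ [disjoint D & B].
Proof. by move=> FD nDA; apply: contra => dDB; apply: (Fcl FB). Qed.

Lemma card_split (D : {set T}) :
  #|D| = #|D :&: A| + #|D :&: B| + #|D :\: (A :|: B)|.
Proof.
rewrite -[LHS](cardsID (A :|: B)) setIUr cardsU.
have -> : (D :&: A) :&: (D :&: B) = set0.
  apply/setP => x; rewrite !inE; apply/negP => /andP[/andP[_ xA] /andP[_ xB]].
  exact: (disjointIn dAB xA xB).
by rewrite cards0 subn0.
Qed.

Lemma meet_card (D E : {set T}) : ~~ [disjoint D & E] = (0 < #|D :&: E|).
Proof. by rewrite -setI_eq0 card_gt0. Qed.

(** [D] meets [A], therefore [B], and also leaves their union; three positive counts with sum 3 are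
    all 1. *)
Lemma mixedP D : D \in mixed ->
  [/\ D \in F, #|D :&: A| = 1, #|D :&: B| = 1 & #|D :\: (A :|: B)| = 1].
Proof.
rewrite inE => /and3P[FD mDA nDAB].
have nDA : D != A by apply: contraNneq nDAB => ->; rewrite subsetUl.
have := meet_both FD nDA mDA; move: mDA; rewrite !meet_card.
have := card_split D; rewrite (F3 FD) => e hA hB.
have : 0 < #|D :\: (A :|: B)| by rewrite card_gt0 setD_eq0.
by split=> //; lia.
Qed.

Lemma fiberP D a b : a \in A -> b \in B -> D \in fiber (a, b) ->
  exists2 x, x \notin A :|: B & D = [set a; b; x].
Proof.
move=> aA bB; rewrite inE /= => /and3P[mD aD bD].
have [FD /eqP/cards1P[a' eA] /eqP/cards1P[b' eB] /eqP/cards1P[x eX]] := mixedP mD.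
have /setDP[_ nx] : x \in D :\: (A :|: B) by rewrite eX set11.
exists x => //.
have ea : a = a' by apply/set1P; rewrite -eA inE aD.
have eb : b = b' by apply/set1P; rewrite -eB inE bD.
by rewrite -(setID D (A :|: B)) setIUr eA eB eX ea eb.
Qed.

(** Double counting: a mixed [D] lies in [#|D :&: A| * #|D :&: B| = 1] fiber. *)
Lemma card_mixed : #|mixed| = \sum_(p in setX A B) #|fiber p|.
Proof.
rewrite -sum1_card.
under [RHS]eq_bigr => p _ do rewrite -sum1_card big_mkcond /=.
rewrite exchange_big /= big_mkcond /=; apply: eq_bigr => D _.
rewrite -big_mkcondr sum1_card /=.
case: ifP => mD; last by apply/esym/eq_card0 => p; rewrite unfold_in /= [D \in fiber p]inE mD andbF.
have [FD hA hB _] := mixedP mD.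
rewrite -[1]/(1 * 1) -{1}hA -hB -cardsX; apply: eq_card => -[a b].
rewrite [RHS]unfold_in /= [_ \in fiber _]inE mD !inE /=.
by move: (a \in D) (a \in A) (b \in D) (b \in B); do 4!case.
Qed.

(** The product counts the positions [(a, b)] that [D] avoids. [D] splits as 1 + 2 or 2 + 1 over [A]
    and [B], so it leaves out two points of one and one point of the other. *)
Lemma innerP D : D \in inner ->
  [/\ D \in F, D \subset A :|: B & #|A :\: D| * #|B :\: D| = 2].
Proof.
rewrite inE => /and4P[FD sD nDA nDB]; split=> //.
have e0 : #|D :\: (A :|: B)| = 0 by apply/eqP; rewrite cards_eq0 setD_eq0.
have := card_split D; rewrite e0 (F3 FD) addn0.
have := cardsID D A; have := cardsID D B; rewrite (F3 FA) (F3 FB) ![_ :&: D]setIC.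
have nA : #|D :&: A| != 3.
  apply: contraNneq nDA => e; rewrite -[X in X == _](_ : D :&: A = _).
    by rewrite eqEcard subsetIr e (F3 FA).
  by apply/eqP; rewrite eqEcard subsetIl e (F3 FD).
have nB : #|D :&: B| != 3.
  apply: contraNneq nDB => e; rewrite -[X in X == _](_ : D :&: B = _).
    by rewrite eqEcard subsetIr e (F3 FB).
  by apply/eqP; rewrite eqEcard subsetIl e (F3 FD).
set u := #|D :&: A| in nA *; set v := #|D :&: B| in nB *.
move=> eB eA e.
have [u1|u2] : u = 1 \/ u = 2 by lia.
  have -> : #|A :\: D| = 2 by lia.
  by have -> : #|B :\: D| = 1 by lia.
have -> : #|A :\: D| = 1 by lia.
by have -> : #|B :\: D| = 2 by lia.
Qed.


Lemma triple_meet (D E S : {set T}) : #|D| = 3 -> #|E| = 3 -> #|S| <= 5 ->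
  D \subset S -> E \subset S -> ~~ [disjoint D & E].
Proof.
move=> D3 E3 S5 DS ES; rewrite meet_card.
have : #|D :|: E| <= 5 by apply: leq_trans S5; rewrite subset_leq_card // subUset DS.
by rewrite cardsU D3 E3; lia.
Qed.

(** * Inner triples against mixed triples, position by position *)

Let avoid (p : T * T) := [set D in inner | (p.1 \notin D) && (p.2 \notin D)].

Lemma card_inner : 2 * #|inner| = \sum_(p in setX A B) #|avoid p|.
Proof.
rewrite mulnC -sum_nat_const.
under [RHS]eq_bigr => p _ do rewrite -sum1_card big_mkcond /=.
rewrite exchange_big /= [LHS]big_mkcond /=; apply: eq_bigr => D _.
rewrite -big_mkcondr sum1_card /=.
case: ifP => iD; last by apply/esym/eq_card0 => p; rewrite unfold_in /= [D \in avoid p]inE iD andbF.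
have [FD sD <-] := innerP iD.
rewrite -cardsX; apply: eq_card => -[a b].
rewrite [RHS]unfold_in /= [_ \in avoid _]inE iD !inE /=.
by move: (a \in D) (a \in A) (b \in D) (b \in B); do 4!case.
Qed.

Lemma avoid_subset p D : D \in avoid p -> D \subset (A :|: B) :\: [set p.1; p.2].
Proof.
rewrite 2!inE => /andP[/and4P[_ sD _ _] /andP[p1 p2]].
apply/subsetP => y yD; rewrite inE in_set2 (subsetP sD) // andbT.
by apply/norP; split; [apply: contraNneq p1 => <-|apply: contraNneq p2 => <-].
Qed.

Lemma card_avoid_ground a b : a \in A -> b \in B ->
  #|(A :|: B) :\: [set a; b]| = 4.
Proof.
move=> aA bB; rewrite cardsD (setIidPr _); last first.
  by rewrite subUset !sub1set !inE aA bB orbT.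
rewrite cardsU (F3 FA) (F3 FB) cards2.
have -> : A :&: B = set0 by apply/eqP; rewrite setI_eq0.
have -> : a != b by apply/eqP => e; apply: (disjointIn dAB aA); rewrite e.
by rewrite cards0.
Qed.

Lemma avoid_fiber_disjoint a b D E : a \in A -> b \in B ->
  D \in avoid (a, b) -> E \in fiber (a, b) -> [disjoint D & E].
Proof.
move=> aA bB aD fE; have [x nx ->] := fiberP aA bB fE.
move: (aD); rewrite 2!inE /= => /andP[/and4P[_ sD _ _] /andP[p1 p2]].
rewrite disjoint_sym disjoints_subset 2!subUset !sub1set !inE p1 p2 /=.
by apply: contra nx; apply: (subsetP sD).
Qed.

(** The avoiding triples live in a set of four points. An empty fiber leaves at most the four
    triples of that set. Given [E] in the fiber, two avoiding triples would be disjoint through [E],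
    impossible in four points, so at most one exists. Given two fiber members, an avoiding triple
    would make them disjoint although they share [a], so none exists. *)
Lemma avoid_bound a b : a \in A -> b \in B ->
  #|avoid (a, b)| + 2 * minn #|fiber (a, b)| 2 <= 4.
Proof.
move=> aA bB; have c4 := card_avoid_ground aA bB.
have inF D : D \in avoid (a, b) -> D \in F by rewrite 2!inE => /andP[/andP[]].
have fF D : D \in fiber (a, b) -> D \in F by rewrite 2!inE => /andP[/andP[]].
have le4 : #|avoid (a, b)| <= 4.
  have <- : #|[set D : {set T} | D \subset (A :|: B) :\: [set a; b] & #|D| == 3]| = 4.
    by rewrite cards_draws c4.
  apply/subset_leq_card/subsetP => D aD.
  by rewrite inE (avoid_subset aD) (F3 (inF _ aD)).
have [|] := leqP #|fiber (a, b)| 0; first by lia.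
case/card_gt0P => E fE.
have le1 : #|avoid (a, b)| <= 1.
  apply/card_le1_eqP => D' D aD' aD; apply/eqP/negPn/negP => nDD'.
  have := Fcl (fF _ fE) (inF _ aD) (inF _ aD') nDD'
    (avoid_fiber_disjoint aA bB aD fE) (avoid_fiber_disjoint aA bB aD' fE).
  apply/negP; apply: triple_meet (avoid_subset aD) (avoid_subset aD').
  - exact: F3 (inF _ aD).
  - exact: F3 (inF _ aD').
  - by rewrite c4.
have [|fib2] := leqP #|fiber (a, b)| 1; first by lia.
have [-> |] := posnP #|avoid (a, b)|; first by lia.
case/card_gt0P => D aD; case/card_gt1P: fib2 => E1 [E2 [fE1 fE2 nE]].
have := Fcl (inF _ aD) (fF _ fE1) (fF _ fE2) nE.
rewrite ![[disjoint _ & D]]disjoint_sym !(avoid_fiber_disjoint aA bB aD) //.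
move=> /(_ isT isT) d; exfalso; apply: (disjointIn (x := a) d).
  by move: fE1; rewrite inE /= => /and3P[].
by move: fE2; rewrite inE /= => /and3P[].
Qed.

Lemma inner_mixed_bound : #|inner| + \sum_(p in setX A B) minn #|fiber p| 2 <= 18.
Proof.
(* After doubling, this is [avoid_bound] summed over nine positions: 9 * 4 = 2 * 18. *)
rewrite -(leq_pmul2l (isT : 0 < 2)) mulnDr card_inner big_distrr -big_split /=.
apply: (@leq_trans (\sum_(p in setX A B) 4)); last first.
  by rewrite sum_nat_const cardsX (F3 FA) (F3 FB).
apply: leq_sum => -[a b]; rewrite inE /= => /andP[aA bB].
exact: avoid_bound.
Qed.

(** Suppose [[set a'; b'; x]] is a member. Discarding [[set a; b; x]] still leaves two triples over
    [(a, b)], both disjoint from that member; the cluster property makes them disjoint, but they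
    share [a]. *)
Lemma fiber_transverse a b a' b' : a \in A -> b \in B -> a' \in A -> b' \in B ->
  a != a' -> b != b' -> 2 < #|fiber (a, b)| -> #|fiber (a', b')| = 0.
Proof.
move=> aA bB a'A b'B naa nbb lt; apply/eqP/negPn/negP; rewrite -lt0n.
case/card_gt0P => E fE.
have fF p D : D \in fiber p -> D \in F by rewrite 2!inE => /andP[/andP[]].
have [x nx eE] := fiberP a'A b'B fE.
have : 1 < #|fiber (a, b) :\ [set a; b; x]|.
  by move: lt; rewrite (cardsD1 [set a; b; x]); case: (_ \in _) => // /ltnW.
have key D : D \in fiber (a, b) :\ [set a; b; x] -> D \in F /\ [disjoint D & E].
  case/setD1P => nD fD; split; first exact: fF fD.
  have [y ny eD] := fiberP aA bB fD.
  have nxy : y != x by apply: contraNneq nD => <-; rewrite eD.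
  have sep u v : u \in A :|: B -> v \notin A :|: B -> u != v.
    by move=> uAB; apply: contraNneq => <-.
  have nAB u v : u \in A -> v \in B -> u != v.
    by move=> uA vB; apply/eqP => e; apply: (disjointIn dAB uA); rewrite e.
  rewrite eD eE disjoints_subset 2!subUset !sub1set !inE !negb_or nxy naa nbb.
  rewrite (nAB a b') // (eq_sym b) (nAB a' b) //=.
  by rewrite andbT !(eq_sym y) !sep // inE ?aA ?bB ?a'A ?b'B ?orbT.
case/card_gt1P => D [D' [fD fD' nDD']].
have [FD dDE] := key D fD; have [FD' dDE'] := key D' fD'.
have := Fcl (fF _ _ fE) FD FD' nDD' dDE dDE'.
apply/negP/pred0Pn; exists a => /=.
move: fD fD' => /setD1P[_ fD] /setD1P[_ fD'].
move: fD; rewrite inE => /and3P[_ /= -> _].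
by move: fD'; rewrite inE => /and3P[].
Qed.

Lemma thin_or_empty_fiber :
  (forall p, p \in setX A B -> #|fiber p| <= 2) \/
  (exists2 q, q \in setX A B & #|fiber q| = 0).
Proof.
have [[a b] /= /andP[/setXP[/= aA bB] lt]|none] :=
  pickP [pred p | (p \in setX A B) && (2 < #|fiber p|)]; last first.
  by left => p pAB; rewrite leqNgt; have := none p; rewrite /= pAB /= => ->.
have other (D : {set T}) x : D \in F -> exists2 y, y \in D & x != y.
  move=> FD; have : 0 < #|D :\ x|.
    by have := cardsD1 x D; rewrite (F3 FD); case: (x \in D); lia.
  by case/card_gt0P => y /setD1P[nyx yD]; exists y; rewrite // eq_sym.
have [a' a'A na] := other A a FA; have [b' b'B nb] := other B b FB.
right; exists (a', b'); first by rewrite inE /= a'A.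
exact: fiber_transverse aA bB a'A b'B na nb lt.
Qed.

Lemma card_positions_but q : q \in setX A B ->
  #|[pred p | (p \in setX A B) && (p != q)]| = 8.
Proof.
move=> qAB; have := cardD1 q (setX A B); rewrite qAB cardsX (F3 FA) (F3 FB).
rewrite -[3 * 3]/(1 + 8) => /addnI ->.
by apply: eq_card => p; rewrite [LHS]unfold_in !inE andbC.
Qed.

(** Only fibers with more than two members exceed the truncated sum. If one exists, some position
    [q] is empty, so at most eight positions contribute an excess, each at most [r - 2]. *)
Lemma mixed_bound r : (forall p, p \in setX A B -> #|fiber p| <= r) ->
  #|mixed| <= \sum_(p in setX A B) minn #|fiber p| 2 + 8 * (r - 2).
Proof.
move=> fr; rewrite card_mixed; have [thin|[q qAB q0]] := thin_or_empty_fiber.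
  apply: leq_trans (leq_addr _ _); apply: leq_sum => p pAB.
  by rewrite leq_min leqnn thin.
rewrite (bigD1 q) //= q0 add0n [in leqRHS](bigD1 q) //= -addnA.
apply: leq_trans (leq_addl _ _).
rewrite -(card_positions_but qAB) -sum_nat_const -big_split /=.
apply: leq_sum => p /andP[pAB _]; have := fr p pAB; rewrite minnE.
by move: #|fiber _| => z; clear; lia.
Qed.

(** The same dichotomy without truncation: nine fibers of size at most 2, or eight of size at most
    [r]. It serves the case of a nonempty [outer], where [r = 3]. *)
Lemma mixed_bound_max r : (forall p, p \in setX A B -> #|fiber p| <= r) ->
  #|mixed| <= maxn 18 (8 * r).
Proof.
move=> fr; rewrite card_mixed leq_max; have [thin|[q qAB q0]] := thin_or_empty_fiber.
  apply/orP; left; rewrite -[18]/(3 * 3 * 2) -{1}(F3 FA) -(F3 FB) -cardsX -sum_nat_const.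
  exact: leq_sum.
apply/orP; right; rewrite (bigD1 q) //= q0 add0n.
rewrite -(card_positions_but qAB) -sum_nat_const.
by apply: leq_sum => p /andP[pAB _]; apply: fr.
Qed.

(** Within a fiber, a triple is determined by its point outside [A :|: B]. *)
Lemma fiber_card (Y : {set T}) p : p \in setX A B ->
  (forall D, D \in mixed -> D :\: (A :|: B) \subset Y) -> #|fiber p| <= #|Y|.
Proof.
case: p => a b /setXP[/= aA bB] sY; apply: (@leq_trans #|[set [set a; b; x] | x in Y]|); last first.
  exact: leq_imset_card.
apply/subset_leq_card/subsetP => D fD; have [x nx eD] := fiberP aA bB fD.
apply/imsetP; exists x => //; apply: (subsetP (sY D _)); first by case/setIdP: fD.
by rewrite inE nx eD !inE eqxx orbT.
Qed.

Lemma card_rest : #|~: (A :|: B)| = #|T| - 6.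
Proof.
rewrite cardsCs setCK cardsU (F3 FA) (F3 FB).
by have -> : A :&: B = set0; [apply/eqP; rewrite setI_eq0|rewrite cards0].
Qed.


(** * Effect of triples missing both [A] and [B], and the resulting bounds *)

Lemma outer_inner C : C \in outer -> inner = set0.
Proof.
case/outerP => FC dCA dCB; apply/setP => D; rewrite [RHS]inE; apply/negP => iD.
have [FD sD _] := innerP iD; move: iD; rewrite inE => /and4P[_ _ nDA nDB].
(* Being inside [A :|: B], [D] misses [C]; through [C] it then misses both [A] and [B], although it
   is nonempty. *)
have dDC : [disjoint D & C].
  rewrite disjoint_sym (disjointWr sD) // disjoints_subset setCU subsetI.
  by rewrite -!disjoints_subset dCA.
have dDA : [disjoint D & A] by apply: (Fcl FC) => //; rewrite disjoint_sym.
have dDB : [disjoint D & B] by apply: (Fcl FC) => //; rewrite disjoint_sym.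
have /card_gt0P[x xD] : 0 < #|D| by rewrite (F3 FD).
have /setUP[xA|xB] := subsetP sD x xD.
  exact: (disjointIn dDA xD xA).
exact: (disjointIn dDB xD xB).
Qed.

(** Otherwise the single point of [D] outside [A :|: B] is not in [C], so [D] misses [C] and,
    through [C], also [A], which a mixed triple meets. *)
Lemma outer_mixed C D : C \in outer -> D \in mixed -> D :\: (A :|: B) \subset C.
Proof.
case/outerP => FC dCA dCB; move=> mD; have [FD _ _ /eqP/cards1P[x eX]] := mixedP mD.
rewrite eX sub1set; apply/negPn/negP => nx.
have nDA : ~~ [disjoint D & A] by move: mD; rewrite inE => /and3P[].
suff dDC : [disjoint D & C].
  apply/negP: nDA; rewrite negbK; apply: (Fcl FC) => //; last by rewrite disjoint_sym.
  by apply: contraTneq mD => ->; rewrite inE subsetUl !andbF.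
rewrite disjoints_subset; apply/subsetP => y yD; rewrite inE.
have [yAB|yn] := boolP (y \in A :|: B).
  apply/negP => yC; case/setUP: yAB => [yA|yB].
    exact: (disjointIn dCA yC yA).
  exact: (disjointIn dCB yC yB).
by have : y \in D :\: (A :|: B); [rewrite inE yn|rewrite eX => /set1P ->].
Qed.

Lemma outer_disjoint C C' : C \in outer -> C' \in outer -> C != C' -> [disjoint C & C'].
Proof. by case/outerP => FC dCA _ /outerP[FC' dCA' _] ne; apply: (Fcl FA). Qed.

Lemma card_outer : 3 * #|outer| <= #|T|.
Proof.
have /eqP tI : trivIset outer by apply/trivIsetP => C C'; apply: outer_disjoint.
have <- : #|cover outer| = 3 * #|outer|.
  by rewrite -tI mulnC -sum_nat_const; apply: eq_bigr => C /outerP[/F3].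
exact: max_card.
Qed.

(** Every outer triple contains the outside point of [D], yet outer triples are pairwise
    disjoint. *)
Lemma outer_le1 D : D \in mixed -> #|outer| <= 1.
Proof.
move=> mD; have [_ _ _ /eqP/cards1P[x eX]] := mixedP mD.
have xC C : C \in outer -> x \in C.
  by move=> oC; have := outer_mixed oC mD; rewrite eX sub1set.
apply/card_le1_eqP => C C' oC oC'; apply/eqP/negPn/negP => nCC.
by apply: (disjointIn (outer_disjoint oC oC' _) (xC C oC) (xC C' oC')); rewrite eq_sym.
Qed.

Lemma cluster_pair_bound : 8 <= #|T| -> #|F| <= 'C(#|T|.-1, 2).
Proof.
move=> T8; apply: leq_trans (linear_le_bin2 T8).
have := cover_pair; have := inner_mixed_bound.
have [o0|/card_gt0P[C oC]] := posnP #|outer|.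
  rewrite o0 addn0.
  (* There are [#|T| - 6] candidates for the third point, and the total is
     [2 + 18 + 8 (#|T| - 8)]. *)
  have : #|mixed| <= \sum_(p in setX A B) minn #|fiber p| 2 + 8 * ((#|T| - 6) - 2).
    apply: mixed_bound => p pAB; rewrite -card_rest; apply: fiber_card => // D mD.
    by apply/subsetP => x; rewrite !inE => /andP[].
  rewrite -subnDA; move: #|T| #|F| #|inner| #|mixed| (\sum_(p in _) _) => t f h m s.
  by clear; lia.
have [FC dCA dCB] := outerP oC.
have T9 : 9 <= #|T|.
  have := subset_leq_card (_ : C \subset ~: (A :|: B)); rewrite card_rest (F3 FC).
  rewrite setCU subsetI -!disjoints_subset dCA dCB => /(_ isT).
  by rewrite leq_subRL //; apply: leq_trans T8.
rewrite (outer_inner oC) cards0.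
have [m0|/card_gt0P[D mD]] := posnP #|mixed|.
  have := card_outer; rewrite m0; move: T9.
  by move: #|T| #|F| #|outer| (\sum_(p in _) _) => t f o s; clear; lia.
have := outer_le1 mD.
(* All third points lie in the triple [C]. The total 2 + 1 + 24 = 27 stays below 28, the value of
   the target at nine points. *)
have : #|mixed| <= maxn 18 (8 * 3).
  apply: mixed_bound_max => p pAB; rewrite -(F3 FC).
  by apply: fiber_card => // E; apply: outer_mixed.
move: T9; move: #|T| #|F| #|mixed| #|outer| (\sum_(p in _) _) => t f m o s.
by clear; lia.
Qed.

Lemma cluster_pair_bound7 : #|T| = 7 ->
  {in F, forall D : {set T}, D \subset A :|: B -> D = A \/ D = B} -> #|F| <= 15.
Proof.
move=> T7 noin; have := cover_pair; have := card_outer; rewrite T7.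
have -> : inner = set0.
  apply/setP => D; rewrite [D \in inner]inE [RHS]inE; apply/negP => /and4P[FD sD nDA nDB].
  by case: (noin D FD sD) => e; [move: nDA|move: nDB]; rewrite e eqxx.
have : #|mixed| <= 9 * 1.
  rewrite card_mixed -[9]/(3 * 3) -{1}(F3 FA) -(F3 FB) -cardsX -sum_nat_const.
  apply: leq_sum => p pAB; have <- : #|~: (A :|: B)| = 1.
    by rewrite card_rest T7.
  by apply: fiber_card => // D mD; apply/subsetP => x; rewrite !inE => /andP[].
have [->|/card_gt0P[C oC]] := posnP #|outer|; first by rewrite cards0; lia.
have [FC dCA dCB] := outerP oC.
have := subset_leq_card (_ : C \subset ~: (A :|: B)); rewrite card_rest (F3 FC) T7.
by rewrite setCU subsetI -!disjoints_subset dCA dCB => /(_ isT).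
Qed.
End DisjointPair.

(** * Pairwise meeting triples: Erdos-Ko-Rado *)

Section Katona.

(** List each set followed by its complement and match the two lists position by position. *)
Lemma perm_set_exists (T : finType) (A B : {set T}) :
  #|A| = #|B| -> exists s : {perm T}, s @: A = B.
Proof.
move=> eAB; pose l (C : {set T}) := enum C ++ enum (~: C).
have lu C : uniq (l C).
  rewrite cat_uniq !enum_uniq /= andbT; apply/hasPn => x.
  by rewrite !mem_enum inE => /negPf ->.
have lm C x : x \in l C by rewrite mem_cat !mem_enum inE orbN.
have ls C : size (l C) = #|T| by rewrite size_cat -!cardE cardsC.
pose f x := nth x (l B) (index x (l A)).
have lt x C : index x (l A) < size (l C) by rewrite ls -(ls A) index_mem.
have fI : injective f.
  move=> x y; rewrite /f (set_nth_default x y) // => /eqP.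
  rewrite nth_uniq // => /eqP e.
  by rewrite -(nth_index x (lm A x)) e nth_index.
exists (perm fI); apply/eqP; rewrite eqEcard card_imset ?eAB ?leqnn ?andbT; last exact: perm_inj.
apply/subsetP => _ /imsetP[x xA ->]; rewrite permE /f nth_cat.
have xe : x \in enum A by rewrite mem_enum.
have -> : index x (l A) < size (enum B).
  by rewrite index_cat xe -cardE -eAB cardE index_mem.
by rewrite -mem_enum mem_nth // index_cat xe -cardE -eAB cardE index_mem.
Qed.

Variable n : nat.
Hypothesis n6 : 5 < n.

(** Addition modulo [n] for [k <= n], by cases so that [lia] can finish after splitting. *)
Definition cyc_shift (i : 'I_n) (k : nat) : nat := if i + k < n then i + k else i + k - n.

Definition arc (i : 'I_n) : {set 'I_n} :=
  [set j : 'I_n | [|| j == i :> nat, j == cyc_shift i 1 :> nat | j == cyc_shift i 2 :> nat]].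

Lemma cyc_shift_lt i k : k < 3 -> cyc_shift i k < n.
Proof. rewrite /cyc_shift; have := ltn_ord i; case: ifP; lia. Qed.

Lemma card_arc i : #|arc i| = 3.
Proof.
have h1 := cyc_shift_lt i (isT : 1 < 3); have h2 := cyc_shift_lt i (isT : 2 < 3).
have -> : arc i = [set i; Ordinal h1; Ordinal h2].
  by apply/setP => j; rewrite !inE -!val_eqE orbA.
rewrite -(setUC [set Ordinal h2]) cardsU1 cards2 !inE -!val_eqE /= /cyc_shift.
have := ltn_ord i; case: ifP; case: ifP; lia.
Qed.

Lemma arc_disjoint (i j : 'I_n) : i + 3 <= j -> j + 3 <= i + n -> [disjoint arc i & arc j].
Proof.
move=> ij ji; apply/pred0P => k; apply/negP => /=; rewrite !inE /cyc_shift.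
have := ltn_ord j; do ! case: ifP; lia.
Qed.

Lemma intersecting_arcs (J : {set 'I_n}) :
  {in J &, forall i j, ~~ [disjoint arc i & arc j]} -> #|J| <= 3.
Proof.
move=> Jint; have [->|/card_gt0P[j0 J0]] := posnP #|J|; first by [].
(* With the least index as origin, cyclic offsets are plain differences; an arc meeting [arc i] has
   offset 0, 1, 2, [n - 2] or [n - 1]. *)
pose i := [arg min_(i < j0 in J) (i : nat)].
have [iJ imin] : i \in J /\ {in J, forall j : 'I_n, i <= j}.
  by rewrite /i; case: arg_minnP.
have near j k : j \in J -> k \in J -> j + 3 <= k -> k + 3 <= j + n -> False.
  by move=> jJ kJ h1 h2; have := Jint j k jJ kJ; rewrite arc_disjoint.
(* Offsets [1] and [n - 2], resp. [2] and [n - 1], from [i] exclude each other. *)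
pose c (j : 'I_n) : 'I_3 := inord (if j - i < 3 then j - i else j - i + 3 - n).
rewrite -(card_in_imset (f := c)); first by rewrite -[leqRHS]card_ord max_card.
move=> j k jJ kJ /(congr1 val); have ij := imin j jJ; have ik := imin k kJ.
have := near i j iJ jJ; have := near i k iJ kJ; have := near j k jJ kJ.
have := near k j kJ jJ; have := ltn_ord j; have := ltn_ord k => ltk ltj n1 n2 n3 n4.
rewrite /= !inordK; try by case: ifP; lia.
move=> e; apply: ord_inj; move: e; do 2 case: ifP; lia.
Qed.

(* Katona's cycle method: a family takes the same proportion of all triples as,
   on average, of the [n] arcs of a random cyclic order. *)
Lemma intersecting_triples_bound (F : {set {set 'I_n}}) :
  {in F, forall D : {set 'I_n}, #|D| = 3} ->
  {in F &, forall D E : {set 'I_n}, ~~ [disjoint D & E]} ->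
  #|F| <= 'C(n.-1, 2).
Proof.
move=> F3 Fint; have n0 : 0 < n by lia.
pose w (A B : {set 'I_n}) := #|[set s : {perm 'I_n} | s @: A == B]|.
(* Precomposing with a permutation from [C] to [A] and postcomposing with one from [B] to [D] is
   injective; hence [w] is constant on triples. *)
have w_le (A B C D : {set 'I_n}) : #|A| = #|C| -> #|B| = #|D| -> w A B <= w C D.
  move=> eAC eBD; have [t tC] := perm_set_exists (esym eAC).
  have [u uB] := perm_set_exists eBD.
  rewrite /w -(card_imset _ (mulgI t)) -(card_imset _ (mulIg u)).
  apply/subset_leq_card/subsetP => _ /imsetP[_ /imsetP[s sAB ->] ->].
  move: sAB; rewrite !inE => /eqP sAB; apply/eqP.
  rewrite -uB -sAB -tC -!imset_comp; apply: eq_imset => x /=.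
  by rewrite !permM.
pose A0 := arc (Ordinal n0); pose c := w A0 A0.
have wE (A B : {set 'I_n}) : #|A| = 3 -> #|B| = 3 -> w A B = c.
  by move=> A3 B3; apply/eqP; rewrite eqn_leq !w_le // ?card_arc.
pose N := #|{perm 'I_n}|.
have Nsum (F' : {set {set 'I_n}}) i :
    {in F', forall D : {set 'I_n}, #|D| = 3} ->
    \sum_(s : {perm 'I_n}) (s @: arc i \in F') = #|F'| * c.
  move=> F'3; rewrite -sum_nat_const.
  transitivity (\sum_(D in F') \sum_(s : {perm 'I_n}) (s @: arc i == D)).
    rewrite exchange_big /=; apply: eq_bigr => s _; case: (boolP (_ \in _)) => h.
      rewrite (bigD1 (s @: arc i)) //= eqxx big1 // => D /andP[_ /negPf].
      by rewrite eq_sym => ->.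
    by rewrite big1 // => D FD; apply/eqP; rewrite eqb0; apply: contraNneq h => ->.
  apply: eq_bigr => D FD; rewrite -(wE (arc i) D) ?card_arc ?F'3 // /w.
  by rewrite -sum1dep_card [RHS]big_mkcond.
(* For the family of all triples, every permutation is counted by [Nsum]. *)
have cN : 'C(n, 3) * c = N.
  have -> : 'C(n, 3) = #|[set D : {set 'I_n} | #|D| == 3]| by rewrite card_draws card_ord.
  rewrite -(Nsum _ (Ordinal n0)) => [|D]; last by rewrite inE => /eqP.
  rewrite /N -sum1_card; apply: eq_bigr => s _.
  by rewrite inE card_imset ?card_arc //; apply: perm_inj.
have c0 : 0 < c.
  by apply/card_gt0P; exists 1%g; rewrite inE (eq_imset _ (perm1 (T := _))) imset_id.
(* Count pairs of an arc and a permutation sending it into [F]: each arc has [#|F| * c]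
   permutations, while the arcs of one permutation pairwise meet, so they are at most three. *)
have le : n * (#|F| * c) <= N * 3.
  have -> : n * (#|F| * c) = \sum_(i < n) \sum_(s : {perm 'I_n}) (s @: arc i \in F).
    by rewrite (eq_bigr _ (fun i _ => Nsum F i F3)) sum_nat_const card_ord.
  rewrite exchange_big -sum_nat_const /=; apply: leq_sum => s _.
  rewrite -big_mkcond /=.
  rewrite sum1dep_card; apply: intersecting_arcs => i j; rewrite !inE => iF jF.
  have := Fint _ _ iF jF; rewrite -!setI_eq0 -imsetI; last by move=> ? ? _ _; apply: perm_inj.
  by rewrite imset_eq0.
have : n * 'C(n.-1, 2) = 3 * 'C(n, 3) by rewrite mul_bin_diag.
rewrite -(leq_pmul2l n0) -(leq_pmul2r c0) => ->.
by rewrite -!mulnA cN (mulnC 3).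
Qed.

End Katona.

(** * Upper bound for Kneser graphs *)

Section Kneser.

Variable n : nat.
Implicit Types (u v w : ksubset n 3) (S : {set ksubset n 3}).

Lemma card_val u : #|val u| = 3.
Proof. exact/eqP/(valP u). Qed.

Lemma val_family_card S : {in [set val u | u in S], forall D : {set 'I_n}, #|D| = 3}.
Proof. by move=> _ /imsetP[u _ ->]; exact: card_val. Qed.

(** If [u] and [v] are different, both adjacent to [w] and not adjacent to each other, then
    [u, w, v] is a geodesic through [w]. *)
Lemma general_position_cluster S :
  general_position (kneser n 3) S -> cluster [set val u | u in S].
Proof.
move=> /general_positionP gpS _ _ _ /imsetP[w wS ->] /imsetP[u uS ->] /imsetP[v vS ->].
move=> /negPf nuv duw dvw; apply/negPn/negP => nd.
have irr t : ~~ kneser n 3 t t by rewrite kneser_irr.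
have wu : w != u by apply: contraNneq (irr u) => wu; rewrite -{2}wu.
have wv : w != v by apply: contraNneq (irr v) => wv; rewrite -{2}wv.
have uv : u != v by apply/eqP => e; rewrite e eqxx in nuv.
have : geodesic (kneser n 3) u v [:: w; v].
  split=> //; first by rewrite /= /kneser duw disjoint_sym dvw.
  case=> [|x [|y q]] //=; first by move=> _ e; rewrite e eqxx in uv.
  by rewrite andbT => ux xv; rewrite -xv in nd; case/negP: nd.
by move/(gpS u v w _ uS vS wS wu wv uv); rewrite !inE eqxx orbT.
Qed.

Lemma ksubset_between (Y : {set 'I_n}) : 3 <= #|Y| -> exists z : ksubset n 3, val z \subset Y.
Proof.
move=> Y3; have : 0 < #|[set D : {set 'I_n} | D \subset Y & #|D| == 3]|.
  by rewrite cards_draws bin_gt0.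
by case/card_gt0P => D; rewrite inE => /andP[DY D3]; exists (exist _ D D3).
Qed.

Lemma common_neighbour u v : 3 + #|val u :|: val v| <= n ->
  exists z, kneser n 3 u z && kneser n 3 z v.
Proof.
move=> le; have [|z zs] := @ksubset_between (~: (val u :|: val v)).
  by rewrite cardsCs setCK card_ord; lia.
exists z; move: zs; rewrite setCU subsetI -!disjoints_subset => /andP[].
by rewrite /kneser (disjoint_sym (val u)) => -> ->.
Qed.

(* In [K(7,3)], triples meeting in one point are at distance 3, in two points at distance 2. *)
Lemma general_position_spread S u v w : n = 7 -> general_position (kneser n 3) S ->
  u \in S -> v \in S -> w \in S -> [disjoint val u & val w] ->
  #|val u :&: val v| = 1 -> #|val w :&: val v| = 2 -> False.
Proof.
move=> n7 /general_positionP gpS uS vS wS duw uv1 wv2.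
have wu : w != u.
  by apply/eqP => e; move: duw; rewrite e -setI_eq0 setIid -cards_eq0 card_val.
have wv : w != v by apply/eqP => e; move: wv2; rewrite e setIid card_val.
have uv : u != v by apply/eqP => e; move: uv1; rewrite e setIid card_val.
have [|z /andP[wz zv]] := @common_neighbour w v; first by rewrite cardsU !card_val wv2 n7.
have : geodesic (kneser n 3) u v [:: w; z; v].
  split=> //; first by rewrite /= wz zv /kneser duw.
  case=> [|x [|y [|t q]]] //=; first by move=> _ e; rewrite e eqxx in uv.
    rewrite andbT => ux xv; move: ux; rewrite xv /kneser -setI_eq0 -cards_eq0.
    by rewrite uv1.
  (* A walk of length two needs a triple in the complement of [val u :|: val v], which has only 7 -
     5 = 2 points. *)
  case/and3P => ux xy _ yv; rewrite yv in xy; have: val x \subset ~: (val u :|: val v).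
    by rewrite setCU subsetI -!disjoints_subset disjoint_sym (ux : [disjoint _ & _]).
  move/subset_leq_card; rewrite card_val cardsCs setCK card_ord cardsU !card_val.
  by rewrite uv1 n7.
by move/(gpS u v w _ uS vS wS wu wv uv); rewrite !inE eqxx orbT.
Qed.

Lemma general_position_bound S : 7 <= n ->
  general_position (kneser n 3) S -> #|S| <= 'C(n.-1, 2).
Proof.
move=> n7 gpS; rewrite -(card_imset (mem S) val_inj).
have F3 := @val_family_card S; have Fcl := general_position_cluster gpS.
have [/exists_inP[A FA /exists_inP[B FB dAB]]|none] :=
  boolP [exists A in [set val u | u in S], exists B in [set val u | u in S],
           [disjoint A & B]]; last first.
  apply: intersecting_triples_bound => // [|A B FA FB]; first by lia.
  apply: contra none => dAB; apply/exists_inP; exists A => //.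
  by apply/exists_inP; exists B.
have [n8|n7'] := leqP 8 n.
  by have := cluster_pair_bound F3 Fcl FA FB dAB; rewrite card_ord => ->.
have {}n7 : n = 7 by lia.
have -> : 'C(n.-1, 2) = 15 by rewrite n7.
apply: (cluster_pair_bound7 F3 Fcl FA FB dAB); first by rewrite card_ord.
move=> D FD sD.
have [->|nDA] := eqVneq D A; first by left.
have [->|nDB] := eqVneq D B; first by right.
have := card_split dAB D; have -> : D :\: (A :|: B) = set0 by apply/eqP; rewrite setD_eq0.
rewrite cards0 addn0 (F3 D FD) ![D :&: _]setIC.
have mA : ~~ [disjoint D & A].
  apply/negP => dDA; have := Fcl _ _ _ FA FD FB nDB dDA.
  rewrite disjoint_sym dAB => /(_ isT) dDB.
  have /card_gt0P[x xD] : 0 < #|D| by rewrite (F3 D).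
  by have /setUP[/(disjointIn dDA xD)|/(disjointIn dDB xD)] := subsetP sD x xD.
have := meet_both Fcl FA FB dAB FD nDA mA; move: mA.
rewrite !meet_card ![D :&: _]setIC.
case/imsetP: FA dAB => a aS ->; case/imsetP: FB => b bS ->; case/imsetP: FD => d dS ->.
move=> dab Ad Bd cd; exfalso.
(* One of [a], [b] meets [d] in one point and the other in two; the geodesic to [d] starts at the
   former and passes through the latter. *)
have [a1|a2] : #|val a :&: val d| = 1 \/ #|val b :&: val d| = 1 by lia.
  apply: (general_position_spread n7 gpS aS dS bS dab a1).
  by apply: (@addnI 1); apply: etrans (esym cd); rewrite a1.
rewrite disjoint_sym in dab.
apply: (general_position_spread n7 gpS bS dS aS dab a2).
by apply: (@addIn 1); apply: etrans (esym cd); rewrite a2.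
Qed.

(** * Lower bound: stars are in general position *)

Lemma kneser_gdist_le3 u v : 7 <= n -> u != v -> ~~ [disjoint val u & val v] ->
  gdist (kneser n 3) u v <= 3.
Proof.
move=> n7 nuv; rewrite meet_card => h.
have uv2 : #|val u :&: val v| <= 2.
  rewrite leqNgt; apply/negP => h3; case/eqP: nuv; apply: val_inj; apply/eqP.
  rewrite eqEcard !card_val leqnn andbT; apply/setIidPl/eqP.
  by rewrite eqEcard subsetIl card_val.
have cU := cardsU (val u) (val v); rewrite !card_val in cU.
have [e2|e1] : #|val u :&: val v| = 2 \/ #|val u :&: val v| = 1 by lia.
  have [|z /andP[uz zv]] := @common_neighbour u v; first by rewrite cU e2.
  by apply: ltnW; apply: (@gdist_le _ _ _ [:: z; v]); rewrite /= uz zv.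
(* The union has five points, so two points [y], [z] lie outside. Completing [val v :\: val u] by
   [y] and [val u :\: val v] by [z] gives the walk [u, p, q, v]. *)
have : 1 < #|~: (val u :|: val v)| by rewrite cardsCs setCK card_ord cU e1; lia.
case/card_gt1P => y [z []]; rewrite !inE !negb_or => /andP[yu yv] /andP[zu zv] nyz.
have cV := cardsID (val u) (val v); have cW := cardsID (val v) (val u).
rewrite !card_val [val v :&: _]setIC e1 in cV cW.
have p3 : #|y |: (val v :\: val u)| == 3 by rewrite cardsU1 !inE (negPf yv) andbF; lia.
have q3 : #|z |: (val u :\: val v)| == 3 by rewrite cardsU1 !inE (negPf zu) andbF; lia.
pose triple (D : {set 'I_n}) : #|D| == 3 -> ksubset n 3 := exist _ D.
pose p := triple _ p3; pose q := triple _ q3.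
apply: (@gdist_le _ _ _ [:: p; q; v]); rewrite /= andbT /kneser /=.
apply/and3P; split; rewrite disjoints_subset; apply/subsetP => x; rewrite !inE.
- move=> xu; rewrite xu negb_or andbT; apply: contraNneq yu => <- //.
- case/orP => [/eqP ->|/andP[xu xv]]; first by rewrite (negPf nyz) (negPf yu) andbF.
  by rewrite xv orbF; apply: contraNneq zv => <-.
- by case/orP => [/eqP ->|/andP[]].
Qed.

Lemma kneser_gdist_ge2 u v : connect (kneser n 3) u v -> u != v ->
  ~~ [disjoint val u & val v] -> 2 <= gdist (kneser n 3) u v.
Proof.
move=> /gdist_walk; case: gdist => [|[|//]] /walkP[p [up pv sp]].
  by move: pv; rewrite (size0nil sp) /= => ->; rewrite eqxx.
case: p sp up pv => [|x []] //= _; rewrite andbT => ux <- _.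
by rewrite [X in ~~ X](ux : [disjoint val u & val x]).
Qed.

Definition star (x : 'I_n) : {set ksubset n 3} := [set u : ksubset n 3 | x \in val u].

(** Distinct members of a star meet, so their distances are 2 or 3, and the sum of two such
    distances is at least 4. *)
Lemma star_general_position (x : 'I_n) : 7 <= n ->
  general_position (kneser n 3) (star x).
Proof.
move=> n7; have meet u v : u \in star x -> v \in star x ->
    ~~ [disjoint val u & val v].
  by rewrite !inE => xu xv; apply/negP => d; apply: (disjointIn d xu xv).
apply/forall_inP => u uS; apply/forall_inP => v vS; apply/forall_inP => w wS.
apply/implyP => /and5P[uv uw wv cuw cwv].
have := kneser_gdist_le3 n7 uv (meet _ _ uS vS).
have := kneser_gdist_ge2 cuw uw (meet _ _ uS wS).
have := kneser_gdist_ge2 cwv wv (meet _ _ wS vS).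
lia.
Qed.

Lemma card_ksubset (k : nat) : #|{: ksubset n k}| = 'C(n, k).
Proof.
rewrite card_sig -[in RHS](card_ord n) -card_draws -sum1dep_card -sum1_card.
by apply: eq_bigl => D; rewrite inE.
Qed.

Lemma card_star (x : 'I_n) : #|star x| = 'C(n.-1, 2).
Proof.
have := cardsC (star x); rewrite card_ksubset.
have -> : #|~: star x| = 'C(n.-1, 3).
  have cx : #|~: [set x]| = n.-1 by rewrite cardsCs setCK card_ord cards1 subn1.
  rewrite -cx -cards_draws -(card_imset _ val_inj); apply: eq_card => D.
  rewrite inE -disjoints_subset disjoint_sym disjoints1.
  apply/imsetP/andP => [[u]|[xD D3]]; first by rewrite !inE => xu ->; rewrite card_val.
  by exists (exist _ D D3); rewrite ?inE.
have n0 : 0 < n := leq_ltn_trans (leq0n x) (ltn_ord x).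
(* Pascal's rule: the triples through [x] are what the triples avoiding [x] leave over. *)
have -> : 'C(n, 3) = 'C(n.-1, 2) + 'C(n.-1, 3) by rewrite -[n in LHS](prednK n0) binS addnC.
exact: addIn.
Qed.

End Kneser.

(** * The case of six points *)

Lemma kneser6_connect (u v w : ksubset 6 3) :
  connect (kneser 6 3) u w -> u != w -> val w = ~: val u.
Proof.
(* The only neighbour of a triple is its complement, so the graph is a perfect matching. *)
have adj (s t : ksubset 6 3) : kneser 6 3 s t -> val t = ~: val s.
  rewrite /kneser disjoint_sym disjoints_subset => st.
  by apply/eqP; rewrite eqEcard st cardsCs setCK card_ord !card_val.
case/connectP => p; elim: p u => [u _ ->|x p IH u]; first by rewrite eqxx.
rewrite /= => /andP[ux xp] wp uw; have [xw|xw] := eqVneq x w.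
  by rewrite -xw; apply: adj.
have := IH x xp wp xw; rewrite (adj _ _ ux) setCK => e.
by case/eqP: uw; apply: val_inj.
Qed.

(** Components have two vertices, so no three different vertices are connected and the condition
    holds vacuously. *)
Lemma kneser6_general_position : general_position (kneser 6 3) setT.
Proof.
apply/forall_inP => u _; apply/forall_inP => v _; apply/forall_inP => w _.
apply/implyP => /and5P[uv uw wv cuw cwv]; exfalso.
case/eqP: uv; apply: val_inj.
by rewrite (kneser6_connect u cwv wv) (kneser6_connect u cuw uw) setCK.
Qed.

Theorem theorem2p4 (n : nat) (hn : 6 <= n) :
  gp (kneser n 3) = if n == 6 then 20 else 'C(n.-1, 2).
Proof.
case: eqP => [->|n6].
  apply/eqP; rewrite eqn_leq; apply/andP; split.
    by apply/bigmax_leqP => S _; rewrite (leq_trans (max_card _)) // card_ksubset.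
  apply: leq_trans (leq_bigmax_cond _ kneser6_general_position).
  by rewrite cardsT card_ksubset.
have n7 : 7 <= n by lia.
have n0 : 0 < n by lia.
apply/eqP; rewrite eqn_leq; apply/andP; split.
  by apply/bigmax_leqP => S; apply: general_position_bound.
rewrite -(card_star (Ordinal n0)).
exact: leq_bigmax_cond (star_general_position _ n7).
Qed.
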